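(* Let $\{G_n\}_{n\ge 0}$ be a Gibonacci sequence. For all positive integers $n$, $$G_{n+2}^2-G_n^2=G_0G_{2n+1}+G_1G_{2n+2}.$$
   Context: A Gibonacci sequence is a sequence satisfying $G_n=G_{n-1}+G_{n-2}$ for $n\ge 2$, with initial values $G_0,G_1$ chosen freely (here arbitrary integers). *)

(* Defs.v *)
From mathcomp Require Import all_boot all_order all_algebra.
Set Implicit Arguments. Unset Strict Implicit. Unset Printing Implicit Defensive.
Import GRing.Theory.
Local Open Scope ring_scope.

(* [G 0] and [G 1] are unconstrained, so they range over arbitrary integers. *)
Definition gibonacci (G : nat -> int) : Prop :=
  forall n : nat, (2 <= n)%N -> G n = G (n - 1)%N + G (n - 2)%N.

(* Main.v *)
Require Import Defs.
From mathcomp Require Import all_boot all_order all_algebra.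
From mathcomp Require Import zify ring.
Local Open Scope ring_scope.

(** The expression [G m * G k + G m.+1 * G k.+1] depends only on [m + k]:
    moving one unit of index from one factor to the other does not change it.
    Hence [G 0 * G (2n+1) + G 1 * G (2n+2)] equals
    [G n * G (n+1) + G (n+1) * G (n+2) = G (n+1) * (G n + G (n+2))], and
    [G (n+1) = G (n+2) - G n] turns this into a difference of squares. *)

Lemma gibonacciSS (G : nat -> int) (hG : gibonacci G) (n : nat) :
  G n.+2 = G n.+1 + G n.
Proof. by rewrite hG // subn1 subn2. Qed.

(** A Honsberger-type identity; for [G] the Fibonacci sequence the left-hand
    side is [G (m + k + 1)].  After the recurrence is applied to the larger
    index, both sides of each index shift are
    [G m * G k.+1 + G m.+1 * G k.+1 + G m.+1 * G k]. *)
Lemma gibonacci_convolution (G : nat -> int) (hG : gibonacci G) (m k : nat) :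
  G 0%N * G (m + k)%N + G 1%N * G (m + k).+1 = G m * G k + G m.+1 * G k.+1.
Proof.
elim: m k => [//|m IHm] k.
by rewrite addSnnS IHm !(gibonacciSS G hG); ring.
Qed.

Theorem mainTheorem2 (G : nat -> int) (hG : gibonacci G) (n : nat) (hn : (0 < n)%N) :
  G (n + 2)%N ^+ 2 - G n ^+ 2 =
  G 0%N * G (2 * n + 1)%N + G 1%N * G (2 * n + 2)%N.
Proof.
have -> : (2 * n + 2 = (n + n.+1).+1)%N by lia.
have -> : (2 * n + 1 = n + n.+1)%N by lia.
by rewrite (gibonacci_convolution G hG) addn2 (gibonacciSS G hG); ring.
Qed.
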